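(* Let $d\ge 2$ be an integer and let $G$ be a finite simple $2d$-regular graph with connected components $G_1,G_2,\ldots,G_q$, where $G_1,\ldots,G_k$ ($0\le k\le q$) are exactly the components with an odd number of vertices, indexed so that $|G_1|\le |G_2|\le\cdots\le |G_k|$. Then: (1) If $0\le k\le 5d+4$, then $G$ admits an antimagic orientation. (2) If $k\ge 5d+5$, let $x_0$ be a positive integer satisfying one of the equations $k=(2d-2)(x+2)+r$ for some $r\in\{0,1,\ldots,d+8\}$, or $k=(2d-2)(x+1)+r$ for some $r\in\{d+9,d+10,\ldots,2d-3\}$ (the paper refers to $x_0$ as the unique positive integer solution of one of these equations). If $|G_1|\ge 2x_0+5$, then $G$ admits an antimagic orientation. *)

(* Defs.v *)
From HB Require Import structures.
From mathcomp Require Import all_boot all_order all_algebra.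
Set Implicit Arguments. Unset Strict Implicit. Unset Printing Implicit Defensive.
Import Order.TTheory GRing.Theory Num.Theory.

Definition simple_graph (V : finType) (e : rel V) : Prop :=
  symmetric e /\ irreflexive e.

Definition regular (V : finType) (e : rel V) (r : nat) : Prop :=
  forall v : V, #|[set w | e v w]| = r.

Definition edges (V : finType) (e : rel V) : {set {set V}} :=
  [set [set x.1; x.2] | x in [set x : V * V | e x.1 x.2]].

Definition component (V : finType) (e : rel V) (v : V) : {set V} :=
  [set w | connect e v w].
Definition components (V : finType) (e : rel V) : {set {set V}} :=
  [set component e v | v in V].
Definition odd_components (V : finType) (e : rel V) : {set {set V}} :=
  [set C in components e | odd #|C|].

(* An orientation of e: o u v means the edge uv is directed from u to v. *)
Definition orientation (V : finType) (e : rel V) (o : rel V) : Prop :=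
  (forall u v, o u v -> e u v) /\
  (forall u v, e u v -> o u v || o v u) /\
  (forall u v, ~~ (o u v && o v u)).

(* A labeling: bijection from the edge set onto {1, ..., |E|}. *)
Definition edge_labeling (V : finType) (e : rel V) (f : {set V} -> nat) : Prop :=
  {in edges e &, injective f} /\
  (forall A, A \in edges e -> 0 < f A <= #|edges e|).

Definition vertex_sum (V : finType) (o : rel V) (f : {set V} -> nat) (v : V) : int :=
  (\sum_(u | o u v) ((f [set u; v])%:Z) - \sum_(w | o v w) ((f [set v; w])%:Z))%R.

Definition has_antimagic_orientation (V : finType) (e : rel V) : Prop :=
  exists (o : rel V) (f : {set V} -> nat),
    [/\ orientation e o, edge_labeling e f & injective (vertex_sum o f)].

(* Main.v *)
Require Import Defs.
From mathcomp Require Import all_boot all_order all_algebra.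
From mathcomp Require Import zify.
Set Implicit Arguments.
Unset Strict Implicit.
Unset Printing Implicit Defensive.
Import Order.TTheory GRing.Theory.

(**
A longest trail in a graph with even degrees is closed and uses every edge at
each of its vertices, so every component has an Euler circuit.  Cut the circuit
of a component with n vertices at the first visit to each vertex: this gives a
cyclic sequence of n chunks, and each vertex is the common end of two
consecutive chunks and an interior point of chunks d - 1 times.  Direct the
chunks alternately forwards and backwards, and label each of them by a block of
consecutive integers, increasing along its direction.  An interior passage
contributes -1, so up to the constant d - 1 the sum at a vertex is a sum of two
last labels (a sink), or minus the sum of two first labels (a source), or, at
the starting vertex of a circuit with an odd number of chunks, the last label of
its last chunk minus the first label of its first chunk.

It remains to order the blocks.  Number the chunks of a circuit alternately from
both ends: the front ones get the levels 0, 2, 4, ... and the back ones 1, 3, 5,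
...  The chunks of all the odd circuits come first, in the order of their
levels, the shorter circuits first on each level; then come those of the even
circuits, ordered in the same way.  The pairs of chunks meeting at the sinks now
form a chain for componentwise comparison, so the sums at the sinks are
distinct, and likewise for the sources.  The first chunk of an odd circuit is a
single edge, whereas its last chunk has at least two edges, since it contains
the remaining d - 1 > 0 visits to the vertex at which it starts.  Therefore,
from one odd circuit to the next, the first label of the first chunk grows by 1
and the last label of the last chunk by at least 2, so that the starting
vertices have distinct sums; these are positive and smaller than the sums at the
sinks.
*)

(** * Euler circuits *)

Section Trails.
Variable V : finType.
Implicit Types (a b u v w x y : V) (p q : seq V) (s t : seq (V * V)).
Implicit Types e : rel V.

Definition arcs x p : seq (V * V) := zip (belast x p) p.

Definition edge_count a b s := count_mem (a, b) s + count_mem (b, a) s.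

Lemma arcs_cat x p q : arcs x (p ++ q) = arcs x p ++ arcs (last x p) q.
Proof. by rewrite /arcs belast_cat zip_cat ?size_belast. Qed.

Lemma arcs_rcons x p y : arcs x (rcons p y) = rcons (arcs x p) (last x p, y).
Proof. by rewrite -cats1 arcs_cat cats1. Qed.

Lemma size_arcs x p : size (arcs x p) = size p.
Proof. by rewrite size2_zip // size_belast. Qed.

Lemma mem_arcs x p a b :
  (a, b) \in arcs x p -> (a \in x :: p) && (b \in x :: p).
Proof.
elim: p x => //= y p IHp x.
rewrite in_cons => /orP[/eqP[-> ->]|/IHp/andP[ya yb]].
  by rewrite mem_head in_cons mem_head orbT.
by rewrite !(in_cons x) ya yb !orbT.
Qed.

Lemma path_arcs e x p :
  (forall a b, (a, b) \in arcs x p -> e a b) -> path e x p.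
Proof.
elim: p x => //= y p IHp x arcs_e; rewrite arcs_e ?mem_head //=.
by apply: IHp => a b ab; apply: arcs_e; rewrite in_cons ab orbT.
Qed.

Lemma edge_count_cat a b s t :
  edge_count a b (s ++ t) = edge_count a b s + edge_count a b t.
Proof. by rewrite /edge_count !count_cat addnACA. Qed.

Lemma edge_count_flatten a b (ss : seq (seq (V * V))) :
  edge_count a b (flatten ss) = \sum_(s <- ss) edge_count a b s.
Proof.
elim: ss => [|s ss IHss]; first by rewrite big_nil.
by rewrite big_cons /= edge_count_cat IHss.
Qed.

Lemma edge_count_perm a b s t :
  perm_eq s t -> edge_count a b s = edge_count a b t.
Proof. by move=> /permP st; rewrite /edge_count !st. Qed.

Lemma edge_count_gt0 a b s :
  (0 < edge_count a b s) = ((a, b) \in s) || ((b, a) \in s).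
Proof. by rewrite addn_gt0 -!has_count !has_pred1. Qed.

Lemma edge_count_uniq s : (forall a b, edge_count a b s <= 1) -> uniq s.
Proof.
move=> le1; apply: count_mem_uniq => -[a b]; have := le1 a b.
rewrite -has_pred1 has_count /edge_count.
by case: (count_mem (a, b) s) => [|[]].
Qed.

Lemma sum_edge_count v s :
  \sum_b edge_count v b s = count_mem v (unzip1 s) + count_mem v (unzip2 s).
Proof.
elim: s => [|[x y] s IHs] /=; first by rewrite big1.
have indicator w (c : bool) : \sum_b (c && (w == b)) = c :> nat.
  case: c => /=; last by rewrite big1.
  by rewrite -big_mkcond (big_pred1 w) // => b; rewrite eq_sym.
rewrite addnACA -IHs -(indicator y (x == v)) -(indicator x (y == v)).
rewrite -!big_split.
apply: eq_bigr => b _; rewrite /edge_count /= !xpair_eqE addnACA.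
by rewrite ![(_ == b) && _]andbC.
Qed.

Lemma sum_edge_count_arcs v x p :
  \sum_b edge_count v b (arcs x p) = count_mem v (belast x p) + count_mem v p.
Proof. by rewrite sum_edge_count unzip1_zip ?unzip2_zip ?size_belast. Qed.

Lemma count_belast v x p :
  count_mem v (belast x p) + (last x p == v) = (x == v) + count_mem v p.
Proof.
by have := congr1 (count_mem v) (lastI x p); rewrite -cats1 count_cat /= addn0.
Qed.

Definition trail e x p :=
  [forall a, forall b, edge_count a b (arcs x p) <= e a b].

Lemma trailP e x p :
  reflect (forall a b, edge_count a b (arcs x p) <= e a b) (trail e x p).
Proof. exact: 'forall_forallP. Qed.

Lemma trail_path e x p : trail e x p -> path e x p.
Proof.
move=> /trailP tr; apply: path_arcs => a b ab; have := tr a b.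
have ab_used : 0 < edge_count a b (arcs x p) by rewrite edge_count_gt0 ab.
by move=> /(leq_trans ab_used); rewrite lt0b.
Qed.

Lemma trail_size e x p : trail e x p -> size p <= #|{: V * V}|.
Proof.
move=> /trailP tr; have arcs_uniq : uniq (arcs x p).
  by apply: edge_count_uniq => a b; exact: leq_trans (tr a b) (leq_b1 _).
by rewrite -(size_arcs x) -(card_uniqP arcs_uniq) max_card.
Qed.

Lemma trail_rcons e x p y :
    symmetric e -> irreflexive e -> trail e x p -> e (last x p) y ->
    edge_count (last x p) y (arcs x p) = 0 ->
  trail e x (rcons p y).
Proof.
move=> e_sym e_irr /trailP tr; set u := last x p => uy unused.
apply/trailP=> a b.
rewrite arcs_rcons -cats1 edge_count_cat -/u /edge_count [X in _ + X]/= !addn0.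
have u_neq_y : (u == y) = false by apply: contraTF uy => /eqP ->; rewrite e_irr.
have [[ua yb]|_] := eqVneq (u, y) (a, b).
  by rewrite -ua -yb [X in X + _]unused uy xpair_eqE u_neq_y.
have [[ub ya]|_] := eqVneq (u, y) (b, a); last by rewrite !addn0 tr.
by rewrite -ub -ya [X in X + _]addnC [X in X + _]unused e_sym uy.
Qed.

Definition longest_trail e x p :=
  trail e x p /\ forall y q, connect e x y -> trail e y q -> size q <= size p.

Lemma longest_trail_exists e x :
  exists y p, connect e x y /\ longest_trail e y p.
Proof.
pose has_trail n :=
  [exists y, connect e x y && [exists t : n.-tuple V, trail e y t]].
have nil_trail : has_trail 0.
  apply/existsP; exists x; rewrite connect0; apply/existsP; exists [tuple].
  exact/trailP.
have bounded n : has_trail n -> n <= #|{: V * V}|.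
  by case/existsP=> y /andP[_ /existsP[t /trail_size]]; rewrite size_tuple.
have [n /existsP[y /andP[xy /existsP[t tr]]] max] :=
  ex_maxnP (ex_intro _ 0 nil_trail) bounded.
exists y, t; split=> //; split=> // z q yz tq; rewrite size_tuple.
apply: max; apply/existsP; exists z; rewrite (connect_trans xy yz).
by apply/existsP; exists (in_tuple q).
Qed.

Section LongestTrail.
Variable e : rel V.
Hypotheses (e_sym : symmetric e) (e_irr : irreflexive e).
Hypothesis even : forall v, ~~ odd (\sum_w e v w).

Lemma longest_trail_end x p w : longest_trail e x p ->
  edge_count (last x p) w (arcs x p) = e (last x p) w.
Proof.
move=> [tr longest]; have := trailP _ _ _ tr (last x p) w.
case: (boolP (e _ w)) => [uw|_]; last by rewrite leqn0 => /eqP.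
rewrite leq_eqVlt => /orP[/eqP //|]; rewrite ltnS leqn0 => /eqP unused.
have := longest x _ (connect0 e x) (trail_rcons e_sym e_irr tr uw unused).
by rewrite size_rcons ltnn.
Qed.

Lemma longest_trail_closed x p : longest_trail e x p -> last x p = x.
Proof.
move=> long; apply/eqP; apply: contraT => open; have := even (last x p).
under eq_bigr do rewrite -(longest_trail_end _ long).
rewrite sum_edge_count_arcs; have := count_belast (last x p) x p.
by rewrite eqxx eq_sym (negPf open); lia.
Qed.

Lemma longest_trail_rot x p u : longest_trail e x p -> u \in x :: p ->
  exists q, [/\ longest_trail e u q, last u q = u &
                perm_eq (arcs u q) (arcs x p)].
Proof.
move=> long; have px := longest_trail_closed long; case: long => tr longest ux.
have xu := path_connect (trail_path tr) ux.
case/splitPl: ux tr longest px => p1 p2 p1u tr longest.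
rewrite last_cat p1u => p2x.
exists (p2 ++ p1); have perm : perm_eq (arcs u (p2 ++ p1)) (arcs x (p1 ++ p2)).
  by rewrite !arcs_cat p1u p2x perm_catC.
split=> //; last by rewrite last_cat p2x.
split=> [|y q uy tq]; last first.
  by rewrite size_cat addnC -size_cat (longest y) // (connect_trans xu uy).
by apply/trailP=> a b; rewrite (edge_count_perm _ _ perm); exact/trailP.
Qed.

Lemma longest_trail_saturated x p u w : longest_trail e x p -> u \in x :: p ->
  edge_count u w (arcs x p) = e u w.
Proof.
move=> long ux; have [q [long_q qu perm]] := longest_trail_rot long ux.
by have := longest_trail_end w long_q; rewrite qu (edge_count_perm _ _ perm).
Qed.

Lemma longest_trail_visits x p : longest_trail e x p -> x :: p =i connect e x.
Proof.
move=> long u; apply/idP/idP => [|xu].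
  by case: long => /trail_path tr _; exact: path_connect tr u.
have visited_closed : closed e [in x :: p].
  apply: intro_closed => [|v w vw]; first exact: sym_connect_sym.
  have : 0 < e v w by rewrite vw.
  move=> + vx; rewrite -(longest_trail_saturated w long vx) edge_count_gt0.
  by case/orP=> /mem_arcs/andP[].
by rewrite -(closed_connect visited_closed xu :
  (x \in x :: p) = (u \in x :: p)) mem_head.
Qed.

Theorem euler_circuit x :
  exists p, [/\ last x p = x, x :: p =i connect e x &
                forall a b, edge_count a b (arcs x p) = e a b && connect e x a].
Proof.
have [y [q [xy long_q]]] := longest_trail_exists e x.
have yx : connect e y x by rewrite (sym_connect_sym e_sym).
have [|p [long_p px _]] := longest_trail_rot long_q (u := x).
  by rewrite longest_trail_visits.
have visits := longest_trail_visits long_p.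
exists p; split=> // a b; have := visits a; rewrite [in RHS]inE => <-.
case: (boolP (a \in _)) => [ax|/negP ax].
  by rewrite andbT (longest_trail_saturated b long_p ax).
apply/eqP; rewrite andbF -leqn0 leqNgt edge_count_gt0.
by apply/negP=> /orP[] /mem_arcs/andP[].
Qed.

End LongestTrail.
End Trails.

(** * Cutting a walk at its first visits *)

Section Cut.
Variable V : eqType.
Implicit Types (u x y : V) (p q c seen : seq V).

Fixpoint fresh seen p : seq V :=
  if p is y :: q then
    if y \in seen then fresh seen q else y :: fresh (y :: seen) q
  else [::].

(* [u] is the last new vertex and [c] the part of the walk traversed since. *)
Fixpoint cut seen u c p : seq (V * seq V) :=
  if p is y :: q then
    if y \in seen then cut seen u (rcons c y) q
    else (u, rcons c y) :: cut (y :: seen) y [::] q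
  else [:: (u, c)].

Lemma mem_fresh seen p : seen ++ fresh seen p =i seen ++ p.
Proof.
elim: p seen => //= y p IHp seen x; case: ifP => [y_seen|_].
  rewrite IHp !mem_cat in_cons; case: eqVneq => // ->.
  by rewrite y_seen.
rewrite !(perm_mem (permEl (perm_catCA seen [:: y] _))).
exact: (IHp (y :: seen)).
Qed.

Lemma uniq_fresh seen p : uniq seen -> uniq (seen ++ fresh seen p).
Proof.
elim: p seen => [|y p IHp] seen uniq_seen /=; first by rewrite cats0.
case: ifPn => [_|y_new]; first exact: IHp.
rewrite (perm_uniq (permEl (perm_catCA seen [:: y] _))).
by rewrite (IHp (y :: seen)) //= y_new.
Qed.

Lemma unzip1_cut seen u c p : unzip1 (cut seen u c p) = u :: fresh seen p.
Proof.
elim: p seen u c => //= y p IHp seen u c.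
by case: ifP => _ /=; rewrite IHp.
Qed.

Lemma last_cut seen u c p :
  [seq last z.1 z.2 | z <- cut seen u c p] =
  rcons (fresh seen p) (last u (c ++ p)).
Proof.
elim: p seen u c => [|y p IHp] seen u c /=; first by rewrite cats0.
case: ifP => _ /=; rewrite IHp ?cat_rcons //=.
by rewrite last_rcons last_cat.
Qed.

Lemma belast_cut z0 seen u c p i :
    {subset u :: c <= seen} -> i < size (cut seen u c p) ->
  let z := nth z0 (cut seen u c p) i in
  {subset belast z.1 z.2 <= seen ++ take i (fresh seen p)}.
Proof.
elim: p seen u c i => [|y p IHp] seen u c i uc_seen /=.
  by case: i => // _ x /mem_belast/uc_seen; rewrite cats0.
case: ifPn => [y_seen|_].
  apply: IHp => x; rewrite -rcons_cons mem_rcons in_cons => /orP[/eqP-> //|].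
  exact: uc_seen.
case: i => [_ x|i lt_i x] /=.
  by rewrite belast_rcons cats0; exact: uc_seen.
rewrite (perm_mem (permEl (perm_catCA seen [:: y] _))).
by apply: IHp lt_i x => z; rewrite !in_cons => /orP[->|].
Qed.

End Cut.

Lemma arcs_cut (V : finType) (seen : seq V) u c p :
  flatten [seq arcs z.1 z.2 | z <- cut seen u c p] = arcs u (c ++ p).
Proof.
elim: p seen u c => [|y p IHp] seen u c /=; first by rewrite !cats0.
case: ifP => _ /=; rewrite IHp ?cat_rcons //.
by rewrite -cat_rcons arcs_cat last_rcons.
Qed.

(** * Chunks of a graph *)

(* Walking along an Euler circuit of each component, [pos v] numbers the
   vertices in the order of their first visits, and [chunk v] is the walk from
   the first visit to [v] up to the next first visit, or to the end. *)
Record chunking (V : finType) (e : rel V) (chunk : V -> seq V) (pos : V -> nat)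
    : Prop := Chunking {
  connect_chunk_end v : connect e v (last v (chunk v));
  pos_chunk_end v : pos (last v (chunk v)) = (pos v).+1 %% #|component e v|;
  pos_lt_card v : pos v < #|component e v|;
  pos_inj u v : connect e u v -> pos u = pos v -> u = v;
  chunk_visits u v :
    u \in belast v (chunk v) -> connect e v u /\ pos u <= pos v;
  sum_edge_count_chunk a b :
    \sum_v edge_count a b (arcs v (chunk v)) = e a b }.

Section FirstVisits.
Variables (V : finType) (e : rel V) (tour : V -> seq V).
Hypothesis e_sym : symmetric e.
Hypothesis tour_closed : forall r, last r (tour r) = r.
Hypothesis tour_visits : forall r, r :: tour r =i connect e r.
Hypothesis tour_count : forall r a b,
  edge_count a b (arcs r (tour r)) = e a b && connect e r a.

Local Notation base := (fingraph.root e).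

Let csym : connect_sym e := sym_connect_sym e_sym.

Definition stops r := r :: fresh [:: r] (tour r).
Definition pieces r := cut [:: r] r [::] (tour r).
Definition first_pos v := index v (stops (base v)).
Definition first_chunk v := (nth (v, [::]) (pieces (base v)) (first_pos v)).2.

Lemma mem_stops r v : (v \in stops r) = connect e r v.
Proof. by rewrite -[RHS](tour_visits r v) [LHS](mem_fresh [:: r]). Qed.

Lemma stops_uniq r : uniq (stops r).
Proof. exact: (uniq_fresh _ (seen := [:: r])). Qed.

Lemma size_stops v : size (stops (base v)) = #|component e v|.
Proof.
rewrite -(card_uniqP (stops_uniq _)); apply: eq_card => w.
by rewrite mem_stops inE -(same_connect csym (connect_root e v)).
Qed.

Lemma unzip1_pieces r : unzip1 (pieces r) = stops r.
Proof. exact: unzip1_cut. Qed.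

Lemma size_pieces r : size (pieces r) = size (stops r).
Proof. by rewrite -unzip1_pieces size_map. Qed.

Lemma first_pos_lt v : first_pos v < size (stops (base v)).
Proof. by rewrite index_mem mem_stops csym connect_root. Qed.

Lemma nth_pieces z0 v :
  nth z0 (pieces (base v)) (first_pos v) = (v, first_chunk v).
Proof.
rewrite (set_nth_default (v, [::])) ?size_pieces ?first_pos_lt //.
rewrite [LHS]surjective_pairing -/(first_chunk v); congr (_, _).
rewrite -(nth_map _ v) ?size_pieces ?first_pos_lt // -/(unzip1 _) unzip1_pieces.
by rewrite nth_index // mem_stops csym connect_root.
Qed.

Lemma last_first_chunk v : last v (first_chunk v) =
  nth v (stops (base v)) ((first_pos v).+1 %% size (stops (base v))).
Proof.
have lt_v := first_pos_lt v; set r := base v in lt_v *.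
have := congr1 (nth v ^~ (first_pos v)) (last_cut [:: r] r [::] (tour r)).
rewrite (nth_map (v, [::])) ?size_pieces // nth_pieces /= tour_closed => ->.
rewrite nth_rcons; move: lt_v; rewrite [size (stops r)]/= ltnS leq_eqVlt.
case/orP=> [/eqP ->|lt_v]; first by rewrite ltnn eqxx modnn.
by rewrite lt_v modn_small.
Qed.

Lemma root_stops v w : w \in stops (base v) -> base w = base v.
Proof.
rewrite mem_stops -(same_connect csym (connect_root e v)).
by move/(fingraph.rootP csym).
Qed.

Lemma last_first_chunk_stops v : last v (first_chunk v) \in stops (base v).
Proof. by rewrite last_first_chunk mem_nth // ltn_mod. Qed.

Lemma pieces_root r : base r = r ->
  pieces r = [seq (v, first_chunk v) | v <- stops r].
Proof.
move=> r_root; apply: (@eq_from_nth _ (r, [::])) => [|i].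
  by rewrite size_map size_pieces.
rewrite size_pieces => lt_i; rewrite (nth_map r) //.
set v := nth r (stops r) i; have rv : base v = r.
  by rewrite -[RHS]r_root; apply: root_stops; rewrite r_root mem_nth.
have <- : first_pos v = i by rewrite /first_pos rv index_uniq ?stops_uniq.
by rewrite -[in LHS]rv nth_pieces.
Qed.

Lemma sum_edge_count_stops r a b : base r = r ->
  \sum_(v | base v == r) edge_count a b (arcs v (first_chunk v)) =
  e a b && (base a == r).
Proof.
move=> r_root; have in_stops v : (base v == r) = (v \in stops r).
  by rewrite mem_stops csym -(root_connect csym) r_root.
rewrite (eq_bigl _ _ in_stops) -big_uniq ?stops_uniq //=.
rewrite -(big_map (fun v => arcs v (first_chunk v)) predT (edge_count a b)).
rewrite -edge_count_flatten (_ : map _ _ = [seq arcs z.1 z.2 | z <- pieces r]).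
  by rewrite arcs_cut tour_count csym -(root_connect csym) r_root.
by rewrite pieces_root // -map_comp.
Qed.

Lemma sum_edge_count_first_chunk a b :
  \sum_v edge_count a b (arcs v (first_chunk v)) = e a b.
Proof.
rewrite (partition_big base (roots e)) => [|v _]; last exact: roots_root.
under eq_bigr => r /eqP r_root do rewrite sum_edge_count_stops //.
rewrite (bigD1 (base a)) ?roots_root //= eqxx andbT big1 ?addn0 // => r.
by rewrite eq_sym => /andP[_ /negPf->]; rewrite andbF.
Qed.

Lemma first_chunk_visits u v : u \in belast v (first_chunk v) ->
  connect e v u /\ first_pos u <= first_pos v.
Proof.
move=> u_chunk; have u_take : u \in take (first_pos v).+1 (stops (base v)).
  have := @belast_cut _ (v, [::]) [:: base v] (base v) [::] (tour (base v))
    (first_pos v) (fun _ => id).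
  by rewrite size_pieces nth_pieces; apply; rewrite ?first_pos_lt.
have u_stop := mem_take u_take.
split; first by rewrite -(root_connect csym) (root_stops u_stop).
by rewrite /first_pos (root_stops u_stop) -ltnS index_ltn.
Qed.

Lemma first_visit_chunking : chunking e first_chunk first_pos.
Proof.
split.
- move=> v; rewrite -(root_connect csym).
  by rewrite (root_stops (last_first_chunk_stops v)).
- move=> v; rewrite /first_pos (root_stops (last_first_chunk_stops v)).
  by rewrite last_first_chunk index_uniq ?stops_uniq ?ltn_mod // size_stops.
- by move=> v; rewrite -size_stops first_pos_lt.
- move=> u v uv; rewrite /first_pos (fingraph.rootP csym uv) => same_index.
  apply: (index_inj u _ _ same_index); rewrite mem_stops csym ?connect_root //.
  exact: connect_trans uv (connect_root e v).
- exact: first_chunk_visits.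
- exact: sum_edge_count_first_chunk.
Qed.

End FirstVisits.

Theorem chunking_exists (V : finType) (e : rel V) :
    symmetric e -> irreflexive e -> (forall v, ~~ odd (\sum_w e v w)) ->
  exists chunk pos, chunking e chunk pos.
Proof.
move=> e_sym e_irr even.
have [tour tourP] := fin_all_exists (euler_circuit e_sym e_irr even).
exists (first_chunk e tour), (first_pos e tour).
by apply: first_visit_chunking => // r; have [] := tourP r.
Qed.

(** * Labelling a list of arcs *)

Section Inflow.
Variable V : finType.
Implicit Types (u v x y : V) (p : seq V) (s t : seq (V * V)) (k : nat).

Definition numbered k s := zip s (iota k.+1 (size s)).

Definition inflow k s v : int :=
  (\sum_(z <- numbered k s | z.1.2 == v) z.2%:Z -
   \sum_(z <- numbered k s | z.1.1 == v) z.2%:Z)%R.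

Definition interior x p := behead (belast x p).

Definition reverse_arcs x p := arcs (last x p) (rev (belast x p)).

Lemma inflow_nil k v : inflow k [::] v = 0%R.
Proof. by rewrite /inflow !big_nil. Qed.

Lemma inflow_cat k s t v :
  inflow k (s ++ t) v = (inflow k s v + inflow (k + size s) t v)%R.
Proof.
rewrite /inflow /numbered size_cat iotaD zip_cat ?size_iota //.
by rewrite !big_cat addSn /= opprD addrACA.
Qed.

Lemma belast_interior x p : 0 < size p -> belast x p = x :: interior x p.
Proof. by case: p. Qed.

Lemma interior_last x p : 0 < size p -> rcons (interior x p) (last x p) = p.
Proof. by case: p => // y p _; rewrite /interior /= -lastI. Qed.

Lemma inflow_arcs k x p v : 0 < size p ->
  inflow k (arcs x p) v =
  ((if last x p == v then (k + size p)%:Z else 0) -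
   (if x == v then k.+1%:Z else 0) - (count_mem v (interior x p))%:Z)%R.
Proof.
have inflow1 j y z : inflow j [:: (y, z)] v =
    ((if z == v then j.+1%:Z else 0) - (if y == v then j.+1%:Z else 0))%R.
  by rewrite /inflow /numbered /= !big_cons !big_nil /= !addr0.
case: p => // y p _; elim: p k x y => [|z p IHp] k x y.
  by rewrite [arcs _ _]/= inflow1 /= addn1 subr0.
rewrite [arcs _ _]/= (inflow_cat k [:: (x, y)]) inflow1 addn1 IHp /interior /=.
by case: (x == v); case: (y == v); case: (last z p == v); lia.
Qed.

Lemma last_rev_belast x p : last (last x p) (rev (belast x p)) = x.
Proof. by case: p => //= y p; rewrite rev_cons last_rcons. Qed.

Lemma interior_rev x p :
  interior (last x p) (rev (belast x p)) = rev (interior x p).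
Proof. by case: p => // y p; rewrite /interior /= rev_cons belast_rcons. Qed.

Lemma edge_count_reverse_arcs a b x p :
  edge_count a b (reverse_arcs x p) = edge_count a b (arcs x p).
Proof.
rewrite /reverse_arcs; elim: p x => //= y p IHp x.
rewrite rev_cons arcs_rcons last_rev_belast -cats1 edge_count_cat IHp.
by rewrite /edge_count /arcs /= !xpair_eqE; lia.
Qed.

Lemma inflow_reverse_arcs k x p v : 0 < size p ->
  inflow k (reverse_arcs x p) v =
  ((if x == v then (k + size p)%:Z else 0) -
   (if last x p == v then k.+1%:Z else 0) - (count_mem v (interior x p))%:Z)%R.
Proof.
move=> p_gt0; rewrite inflow_arcs ?size_rev ?size_belast // last_rev_belast.
by rewrite interior_rev count_rev.
Qed.

Lemma inflow_flatten (disp : Order.disp_t) (T : orderType disp) (I : eqType)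
    (key : I -> T) (F : I -> seq (V * V)) (r : seq I) k v :
    sorted (relpre key <%O) r ->
  inflow k (flatten (map F r)) v =
  (\sum_(i <- r)
     inflow (k + \sum_(j <- r | (key j < key i)%O) size (F j))%N (F i) v)%R.
Proof.
rewrite sorted_pairwise; last by move=> j i l; exact: lt_trans.
elim: r k => [|i r IHr] k; first by rewrite inflow_nil big_nil.
rewrite [pairwise _ _]/= => /andP[/allP/= lt_i r_sorted].
rewrite /= inflow_cat (IHr _ r_sorted) !big_cons ltxx.
congr (inflow _ _ _ + _)%R.
  by rewrite big_seq_cond big1 ?addn0 // => j /andP[/lt_i/lt_gtF->].
by apply: eq_big_seq => j /lt_i lt_ij; rewrite big_cons lt_ij addnA.
Qed.

End Inflow.

Lemma set2_inj (T : finType) (a b c d : T) :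
  [set a; b] = [set c; d] -> (a, b) = (c, d) \/ (a, b) = (d, c).
Proof.
move=> same_set; have := set21 a b; have := set22 a b; rewrite same_set !inE.
have := set21 c d; have := set22 c d; rewrite -same_set !inE.
by do 4![move=> /orP[]/eqP ?]; subst; auto.
Qed.

Lemma big_seq_reindex (R : Type) (idx : R) (op : Monoid.com_law idx)
    (T U : finType) (s : seq T) (P : pred T) (h : U -> T) (g : T -> U)
    (F : T -> R) :
    uniq s -> cancel h g -> (forall u, P (h u)) ->
    (forall z, P z -> h (g z) = z) ->
  \big[op/idx]_(z <- s | P z) F z = \big[op/idx]_(u | h u \in s) F (h u).
Proof.
move=> s_uniq hK Ph gK; rewrite -big_filter big_uniq ?filter_uniq //=.
rewrite (reindex_onto h g) => [|z]; last by rewrite mem_filter => /andP[/gK].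
by apply: eq_bigl => u; rewrite mem_filter Ph hK eqxx andbT.
Qed.

Section ArcListLabeling.
Variables (V : finType) (e : rel V) (s : seq (V * V)).
Hypothesis countE : forall a b, edge_count a b s = e a b.
Implicit Types (a b u v : V) (z : V * V) (A : {set V}).

Definition arc_edge z : {set V} := [set z.1; z.2].
Definition arc_edges := map arc_edge s.
Definition arc_label A := (index A arc_edges).+1.

Lemma edge_mem a b : e a b = ((a, b) \in s) || ((b, a) \in s).
Proof. by rewrite -edge_count_gt0 countE lt0b. Qed.

Lemma arcs_asym a b : (a, b) \in s -> (b, a) \notin s.
Proof.
rewrite -!has_pred1 !has_count -leqNgt => ab.
by have := leq_b1 (e a b); rewrite -countE /edge_count; lia.
Qed.

Lemma arc_list_uniq : uniq s.
Proof. by apply: edge_count_uniq => a b; rewrite countE leq_b1. Qed.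

Lemma arc_edges_uniq : uniq arc_edges.
Proof.
rewrite map_inj_in_uniq ?arc_list_uniq // => -[a b] [c d] ab cd.
by case/set2_inj=> // -[ad bc]; have := arcs_asym ab; rewrite ad bc cd.
Qed.

Lemma mem_arc_edges : arc_edges =i edges e.
Proof.
move=> A; apply/mapP/imsetP => [[z zs ->]|[z]].
  by exists z => //; rewrite inE edge_mem -surjective_pairing zs.
rewrite inE edge_mem -surjective_pairing => /orP[zs|zs] ->; first by exists z.
by exists (z.2, z.1); rewrite // /arc_edge setUC.
Qed.

Lemma arc_list_orientation : orientation e (fun a b => (a, b) \in s).
Proof.
split=> [a b ab|]; first by rewrite edge_mem ab.
split=> [a b|a b]; first by rewrite edge_mem.
by apply/negP=> /andP[/arcs_asym/negP].
Qed.

Lemma arc_label_edge_labeling : edge_labeling e arc_label.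
Proof.
split=> [A B|A]; rewrite -!mem_arc_edges => A_in.
  by move=> B_in [same_index]; exact: (index_inj set0 A_in B_in same_index).
by rewrite /= -(eq_card mem_arc_edges) (card_uniqP arc_edges_uniq) index_mem.
Qed.

Lemma numbered_arc_label :
  numbered 0 s = [seq (z, arc_label (arc_edge z)) | z <- s].
Proof.
have labels : iota 1 (size s) = [seq arc_label (arc_edge z) | z <- s].
  rewrite (map_comp arc_label) -/arc_edges -(size_map arc_edge) -/arc_edges.
  apply: (@eq_from_nth _ 0) => [|i]; rewrite ?size_map size_iota // => lt_i.
  rewrite nth_iota // (nth_map set0) ?size_map // /arc_label.
  by rewrite index_uniq ?arc_edges_uniq ?size_map.
by rewrite /numbered labels -{1}[s]map_id zip_map.
Qed.

Lemma vertex_sum_arc_label v :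
  vertex_sum (fun a b => (a, b) \in s) arc_label v = inflow 0 s v.
Proof.
rewrite /inflow numbered_arc_label !big_map /vertex_sum; congr (_ - _)%R.
  rewrite (big_seq_reindex _ _ arc_list_uniq (h := pair^~ v) (g := fst)) //.
  by move=> [a b] /eqP <-.
rewrite (big_seq_reindex _ _ arc_list_uniq (h := pair v) (g := snd)) //.
by move=> [a b] /eqP <-.
Qed.

End ArcListLabeling.

(** * Consecutive blocks of labels *)

Section Blocks.
Context {disp : Order.disp_t} {T : orderType disp} {V : finType}.
Variables (key : V -> T) (sz : V -> nat) (backward : pred V).
Implicit Types u v w : V.

Definition block_offset v := \sum_(w | (key w < key v)%O) sz w.
Definition block_first v := (block_offset v).+1.
Definition block_last v := block_offset v + sz v.

Definition block_start v : int :=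
  (if backward v then (block_last v)%:Z else - (block_first v)%:Z)%R.
Definition block_end v : int :=
  (if backward v then - (block_first v)%:Z else (block_last v)%:Z)%R.

Hypothesis key_inj : injective key.

Lemma block_lastE v : block_last v = \sum_(w | (key w <= key v)%O) sz w.
Proof.
rewrite [RHS](bigD1 v) //= addnC; congr (_ + _); apply: eq_bigl => w.
by rewrite lt_neqAle (inj_eq key_inj) andbC.
Qed.

Lemma block_last_between u v : (key u <= key v)%O ->
  block_last v = block_last u + \sum_(w | (key u < key w <= key v)%O) sz w.
Proof.
move=> le_uv; rewrite !block_lastE (bigID (fun w => key w <= key u)%O) /=.
congr (_ + _); apply: eq_bigl => w; last by rewrite -ltNge andbC.
by case: (boolP (key w <= key u)%O) => [/le_trans->|]; rewrite ?andbF.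
Qed.

Lemma block_last_le_offset u v :
  (key u < key v)%O -> block_last u <= block_offset v.
Proof.
rewrite block_lastE => lt_uv; apply: (sub_le_big leqnn) => [m n|w le_wu].
  exact: leq_addr.
exact: le_lt_trans le_wu lt_uv.
Qed.

Hypothesis sz_gt0 : forall v, 0 < sz v.

Lemma block_first_mono u v : (key u < key v)%O -> block_first u < block_first v.
Proof.
move=> /block_last_le_offset; have := sz_gt0 u.
by rewrite /block_first /block_last; lia.
Qed.

Lemma block_last_mono u v : (key u < key v)%O -> block_last u < block_last v.
Proof.
by move=> /block_last_le_offset; have := sz_gt0 v; rewrite /block_last; lia.
Qed.

End Blocks.

Section ChunkLabeling.
Context {disp : Order.disp_t} {T : orderType disp} {V : finType}.
Variables (e : rel V) (chunk : V -> seq V) (prv : V -> V).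
Variables (key : V -> T) (backward : pred V).
Hypothesis countE : forall a b,
  \sum_v edge_count a b (arcs v (chunk v)) = e a b.
Hypothesis chunk_gt0 : forall v, 0 < size (chunk v).
Hypothesis chunk_end_eq : forall u v, (last u (chunk u) == v) = (u == prv v).
Hypothesis key_inj : injective key.
Implicit Types u v w : V.

Local Notation sz := (fun v => size (chunk v)).

Definition directed_chunk v :=
  if backward v then reverse_arcs v (chunk v) else arcs v (chunk v).

Lemma size_directed_chunk v : size (directed_chunk v) = size (chunk v).
Proof.
by rewrite /directed_chunk; case: ifP; rewrite size_arcs ?size_rev ?size_belast.
Qed.

Lemma edge_count_directed_chunk a b v :
  edge_count a b (directed_chunk v) = edge_count a b (arcs v (chunk v)).
Proof.
by rewrite /directed_chunk; case: ifP; rewrite ?edge_count_reverse_arcs.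
Qed.

Lemma inflow_directed_chunk u v :
  inflow (block_offset key sz u) (directed_chunk u) v =
  ((if u == v then block_start key sz backward u else 0) +
   (if u == prv v then block_end key sz backward u else 0)
   - (count_mem v (interior u (chunk u)))%:Z)%R.
Proof.
rewrite /directed_chunk /block_start /block_end -chunk_end_eq.
rewrite /block_first /block_last.
case: (backward u); rewrite ?inflow_reverse_arcs ?inflow_arcs ?chunk_gt0 //=.
  by case: (u == v); case: (last u _ == v); lia.
by case: (u == v); case: (last u _ == v); lia.
Qed.

Definition arc_list :=
  flatten [seq directed_chunk v | v <- sort (relpre key <=%O) (enum V)].

Lemma edge_count_arc_list a b : edge_count a b arc_list = e a b.
Proof.
rewrite edge_count_flatten big_map (perm_big _ (permEl (perm_sort _ _))).
rewrite big_enum -countE /=.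
by apply: eq_bigr => v _; exact: edge_count_directed_chunk.
Qed.

Lemma inflow_arc_list v :
  inflow 0 arc_list v =
  (block_start key sz backward v + block_end key sz backward (prv v) -
   (\sum_u count_mem v (interior u (chunk u)))%:Z)%R.
Proof.
rewrite (inflow_flatten (key := key)); last first.
  rewrite -sorted_map lt_sorted_uniq_le map_inj_uniq // sort_uniq enum_uniq.
  by rewrite sorted_map sort_sorted // => x y; exact: le_total.
rewrite (perm_big _ (permEl (perm_sort _ _))) big_enum /=.
under eq_bigr => u _.
  rewrite (perm_big _ (permEl (perm_sort _ _))) big_enum_cond.
  under eq_bigr do rewrite size_directed_chunk.
  rewrite add0n inflow_directed_chunk; over.
rewrite sumrB big_split /= -!big_mkcond /= !big_pred1_eq.
by rewrite (big_morph Posz PoszD (erefl 0%:Z)%R).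
Qed.

Theorem chunk_labeling :
  exists (o : rel V) (f : {set V} -> nat),
    [/\ orientation e o, edge_labeling e f &
        forall v, vertex_sum o f v =
          (block_start key sz backward v + block_end key sz backward (prv v) -
           (\sum_u count_mem v (interior u (chunk u)))%:Z)%R].
Proof.
exists (fun a b => (a, b) \in arc_list), (arc_label arc_list).
split=> [||v]; first exact: arc_list_orientation edge_count_arc_list.
  exact: arc_label_edge_labeling edge_count_arc_list.
by rewrite (vertex_sum_arc_label edge_count_arc_list) inflow_arc_list.
Qed.

End ChunkLabeling.

(** * The order of the chunks *)

(* Numbers the points of a cycle of length [n] alternately from both ends:
   [0, 2, 4, ...] from the front and [1, 3, 5, ...] from the back. *)
Definition zigzag n i := if i.*2 < n then i.*2 else (n - i).*2.-1.

Definition cyc_pred n i := if i == 0 then n.-1 else i.-1.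

Definition lower_level n i := minn (zigzag n (cyc_pred n i)) (zigzag n i).
Definition upper_level n i := maxn (zigzag n (cyc_pred n i)) (zigzag n i).

Lemma zigzag_inj n i j : i < n -> j < n -> zigzag n i = zigzag n j -> i = j.
Proof. by rewrite /zigzag; do 2![case: ifP => ?]; lia. Qed.

Variant junction_spec n i : nat -> nat -> Prop :=
| StartJunction of i = 0 : junction_spec n i 0 1
| FrontJunction l of i.*2 = l.+2 & l.+2 < n : junction_spec n i l l.+2
| BackJunction l of i.*2 + l.+1 = n.*2 & l.+2 < n : junction_spec n i l l.+2
| EvenTurn l of i.*2 = n & n = l.+2 : junction_spec n i l l.+1
| OddTurn l of i.*2 = n.+1 & n = l.+2 : junction_spec n i l l.+1.

Lemma junctionP n i : 1 < n -> i < n ->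
  junction_spec n i (lower_level n i) (upper_level n i).
Proof.
rewrite /lower_level /upper_level => n_gt1 lt_in.
have at_levels l m a b : minn a b = l -> maxn a b = m ->
    junction_spec n i l m -> junction_spec n i (minn a b) (maxn a b).
  by move=> -> ->.
rewrite /zigzag /cyc_pred; have [i0|i_gt0] := posnP i.
  subst i; rewrite ifF ?ifT; try lia.
  by apply: (at_levels 0 1); [lia|lia|exact: StartJunction].
have [front|not_front] := ltnP i.*2 n.
  rewrite ifT; last by lia.
  by apply: (at_levels i.*2.-2 i.*2.-2.+2); [lia|lia|apply: FrontJunction; lia].
have [turn|back] := ltnP i.-1.*2 n; last first.
  apply: (at_levels (n - i).*2.-1 (n - i).*2.-1.+2); [lia|lia|].
  by apply: BackJunction; lia.
have [even_n|odd_n] := eqVneq i.*2 n.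
  by apply: (at_levels n.-2 n.-2.+1); [lia|lia|apply: EvenTurn; lia].
by apply: (at_levels n.-2 n.-2.+1); [lia|lia|apply: OddTurn; lia].
Qed.

(* Along the cycles of a fixed parity, the pairs of levels that meet at points
   of a fixed parity form a chain. *)
Lemma junction_chain n m i j :
    1 < n -> n <= m -> odd n = odd m -> i < n -> j < m -> odd i = odd j ->
    ~~ (odd n && (i == 0)) -> ~~ (odd m && (j == 0)) ->
  (lower_level n i <= lower_level m j) = (upper_level n i <= upper_level m j).
Proof.
move=> n_gt1 le_nm par_n lt_in lt_jm par_i turn_i turn_j.
have m_gt1 : 1 < m by exact: leq_trans n_gt1 le_nm.
case: (junctionP n_gt1 lt_in) => [?|l ? ?|l ? ?|l ? ?|l ? ?];
case: (junctionP m_gt1 lt_jm) => [?|l' ? ?|l' ? ?|l' ? ?|l' ? ?]; lia.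
Qed.

(* [prv] permutes [V] in cycles, which are told apart by [rank]; [len v] is the
   length of the cycle of [v] and [pos v] the position of [v] on it. *)
Section ChunkOrder.
Variables (V : finType) (prv : V -> V) (pos len rank : V -> nat).
Hypothesis len_gt1 : forall v, 1 < len v.
Hypothesis pos_lt_len : forall v, pos v < len v.
Hypothesis rank_pos_inj : forall u v, rank u = rank v -> pos u = pos v -> u = v.
Hypothesis rank_len : forall u v, rank u = rank v -> len u = len v.
Hypothesis rank_prv : forall v, rank (prv v) = rank v.
Hypothesis pos_prv : forall v, pos (prv v) = cyc_pred (len v) (pos v).
Implicit Types (u v w x y : V).

Definition level v := zigzag (len v) (pos v).

Definition key v : seqlexi nat :=
  [:: ~~ odd (len v) : nat; level v; len v; rank v].

Let len_prv v : len (prv v) = len v. Proof. exact: rank_len (rank_prv v). Qed.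

Lemma key_leE u v : (key u <= key v)%O =
  (~~ odd (len u) <= ~~ odd (len v)) && ((~~ odd (len v) <= ~~ odd (len u)) ==>
    (level u <= level v) && ((level v <= level u) ==>
      (len u <= len v) && ((len v <= len u) ==> (rank u <= rank v)))).
Proof. by rewrite /key !lexi_cons lexi0s implybT andbT !leEnat. Qed.

Lemma key_ltE u v : (key u < key v)%O = ~~ (key v <= key u)%O.
Proof. exact: ltNge. Qed.

Lemma key_inj : injective key.
Proof.
move=> u v [_ same_level same_len /rank_pos_inj]; apply.
move: same_level; rewrite /level same_len; apply: zigzag_inj => //.
by rewrite -same_len.
Qed.

Definition odd_root v := odd (len v) && (pos v == 0).

Lemma odd_pos_prv v : ~~ odd_root v -> odd (pos (prv v)) = ~~ odd (pos v).
Proof.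
rewrite /odd_root pos_prv /cyc_pred; have := pos_lt_len v.
by case: eqP; lia.
Qed.

Definition lower_chunk v := if level (prv v) < level v then prv v else v.
Definition upper_chunk v := if level (prv v) < level v then v else prv v.

Lemma level_prv v : level (prv v) = zigzag (len v) (cyc_pred (len v) (pos v)).
Proof. by rewrite /level len_prv pos_prv. Qed.

Lemma level_lower v : level (lower_chunk v) = lower_level (len v) (pos v).
Proof. by rewrite (fun_if level) -/(minn _ _) level_prv. Qed.

Lemma level_upper v : level (upper_chunk v) = upper_level (len v) (pos v).
Proof. by rewrite (fun_if level) -/(maxn _ _) level_prv. Qed.

Lemma rank_lower v : rank (lower_chunk v) = rank v.
Proof. by rewrite /lower_chunk; case: ifP. Qed.

Lemma rank_upper v : rank (upper_chunk v) = rank v.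
Proof. by rewrite /upper_chunk; case: ifP. Qed.

Lemma key_chain u v :
    ~~ odd_root u -> ~~ odd_root v -> odd (pos u) = odd (pos v) ->
  (key (lower_chunk u) <= key (lower_chunk v))%O =
  (key (upper_chunk u) <= key (upper_chunk v))%O.
Proof.
move=> turn_u turn_v par.
have len_lower w := rank_len (rank_lower w).
have len_upper w := rank_len (rank_upper w).
rewrite !key_leE !(rank_lower, rank_upper, level_lower, level_upper).
rewrite !(len_lower, len_upper).
have [par_len|] := eqVneq (odd (len u)) (odd (len v)); last first.
  by case: (odd (len u)); case: (odd (len v)).
rewrite par_len leqnn /=.
have chain_uv le_uv := junction_chain (len_gt1 u) le_uv par_len
  (pos_lt_len u) (pos_lt_len v) par turn_u turn_v.
have chain_vu le_vu := junction_chain (len_gt1 v) le_vu (esym par_len)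
  (pos_lt_len v) (pos_lt_len u) (esym par) turn_v turn_u.
case: (ltngtP (len u) (len v)) => [/ltnW lt_uv|/ltnW lt_vu|eq_uv] /=.
- by rewrite !implybT !andbT chain_uv.
- by have := chain_vu lt_vu; rewrite !implybF; lia.
- by rewrite chain_uv ?chain_vu // eq_uv.
Qed.

Lemma lower_upper_sum (E : V -> nat) v :
  E (prv v) + E v = E (lower_chunk v) + E (upper_chunk v).
Proof.
by rewrite /lower_chunk /upper_chunk; case: ifP => // _; rewrite addnC.
Qed.

Lemma junction_sum_inj (E : V -> nat) u v :
    {homo E : x y / (key x < key y)%O >-> x < y} ->
    ~~ odd_root u -> ~~ odd_root v -> odd (pos u) = odd (pos v) ->
    E (prv u) + E u = E (prv v) + E v ->
  u = v.
Proof.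
move=> E_mono; rewrite !lower_upper_sum.
wlog le_lower : u v / (key (lower_chunk u) <= key (lower_chunk v))%O.
  case: (leP (key (lower_chunk u)) (key (lower_chunk v))) => [|/ltW] le_lower.
    by move=> /(_ u v le_lower).
  move=> /(_ v u le_lower) inj_vu turn_u turn_v par sumE.
  by apply/esym/inj_vu.
move=> turn_u turn_v par.
have le_upper := le_lower; rewrite key_chain // in le_upper.
have E_le x y : (key x <= key y)%O -> E x <= E y /\ (E x = E y -> x = y).
  rewrite le_eqVlt => /orP[/eqP/key_inj-> //|/E_mono lt_xy].
  by split=> [|E_xy]; [exact: ltnW | rewrite E_xy ltnn in lt_xy].
have [le_E_lower eq_lower] := E_le _ _ le_lower.
have [le_E_upper eq_upper] := E_le _ _ le_upper.
move=> sumE.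
have lowerE : lower_chunk u = lower_chunk v by apply: eq_lower; lia.
have upperE : upper_chunk u = upper_chunk v by apply: eq_upper; lia.
have prv_u_neq_v : prv u <> v.
  by move=> uv; have := odd_pos_prv turn_u; rewrite uv par; case: odd.
move: lowerE upperE; rewrite /lower_chunk /upper_chunk.
by do 2![case: ifP => _] => // [/prv_u_neq_v|_ /prv_u_neq_v].
Qed.

Lemma prv_inj : injective prv.
Proof.
move=> u v eq_prv; have rank_uv : rank u = rank v.
  by rewrite -rank_prv eq_prv rank_prv.
apply: rank_pos_inj => //.
have := congr1 pos eq_prv; rewrite !pos_prv /cyc_pred.
have := pos_lt_len u; have := pos_lt_len v; rewrite (rank_len rank_uv).
by do 2!case: eqP; lia.
Qed.

Lemma level_odd_root x : odd_root x -> level x = 0.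
Proof. by case/andP=> _ /eqP pos0; rewrite /level pos0 /zigzag ltnW. Qed.

Lemma level_prv_odd_root x : odd_root x -> level (prv x) = 1.
Proof.
case/andP=> odd_len /eqP pos0; have := len_gt1 x.
by rewrite level_prv pos0 /zigzag /cyc_pred /=; case: ifP; lia.
Qed.

Lemma odd_root_level w : odd (len w) -> level w = 0 -> odd_root w.
Proof.
rewrite /odd_root => -> /=; rewrite /level /zigzag; have := pos_lt_len w.
by case: ifP; lia.
Qed.

Lemma odd_root_le y w : odd_root y -> (key w <= key y)%O -> odd_root w.
Proof.
move=> root_y; have [/andP[odd_y _] level_y] := (root_y, level_odd_root root_y).
rewrite key_leE odd_y level_y.
case odd_w: (odd (len w)) => //= /andP[level_w _].
by apply: odd_root_level => //; lia.
Qed.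

Lemma key_prv_odd_root x y : odd_root x -> odd_root y ->
  (key (prv x) <= key (prv y))%O = (key x <= key y)%O.
Proof.
move=> root_x root_y; rewrite !key_leE !len_prv !rank_prv.
by rewrite !level_prv_odd_root // !level_odd_root.
Qed.

Variable sz : V -> nat.
Hypothesis sz_gt0 : forall v, 0 < sz v.
Hypothesis sz_odd_root : forall x, odd_root x -> sz x = 1.
Hypothesis sz_prv_odd_root : forall x, odd_root x -> 1 < sz (prv x).

Local Notation first_label := (block_first key sz).
Local Notation last_label := (block_last key sz).

Lemma odd_root_sum_mono x y : odd_root x -> odd_root y -> (key x < key y)%O ->
  last_label (prv x) + first_label y < last_label (prv y) + first_label x.
Proof.
move=> root_x root_y lt_xy; have le_xy := ltW lt_xy.
have first_root z : odd_root z -> first_label z = last_label z.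
  by move=> /sz_odd_root; rewrite /block_last => ->; rewrite addn1.
rewrite !first_root // (block_last_between sz key_inj le_xy).
rewrite (block_last_between sz key_inj (u := prv x) (v := prv y));
  last by rewrite key_prv_odd_root.
have grows : \sum_(w | (key x < key w <= key y)%O) sz w <
    \sum_(w | (key x < key w <= key y)%O) sz (prv w).
  rewrite (bigD1 y) ?[X in _ < X](bigD1 y) /= ?lt_xy ?lexx //.
  rewrite -addSn; apply: leq_add; first by rewrite sz_odd_root ?sz_prv_odd_root.
  by apply: leq_sum => w /andP[/andP[_ /(odd_root_le root_y)/sz_odd_root->]].
have shifts : \sum_(w | (key x < key w <= key y)%O) sz (prv w) <=
    \sum_(w | (key (prv x) < key w <= key (prv y))%O) sz w.
  rewrite [X in _ <= X](reindex_inj prv_inj) /=.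
  apply: (sub_le_big leqnn (fun m n => leq_addr n m)) => w /andP[lt_xw le_wy].
  have root_w := odd_root_le root_y le_wy.
  by rewrite key_ltE !key_prv_odd_root // -key_ltE lt_xw.
by rewrite -addnA ltn_add2l addnC ltn_add2r; exact: leq_trans grows shifts.
Qed.

Lemma last_prv_odd_root_lt_sink x v : odd_root x -> odd (pos v) ->
  last_label (prv x) < last_label v.
Proof.
move=> root_x odd_v; apply: (block_last_mono key_inj sz_gt0).
have := level_prv_odd_root root_x; case/andP: root_x => odd_x _ level_x.
rewrite key_ltE key_leE len_prv odd_x level_x.
case odd_len: (odd (len v)); rewrite //= negb_and -ltnNge; apply/orP; left.
by rewrite /level /zigzag; have := pos_lt_len v; case: ifP; lia.
Qed.

Lemma first_label_odd_root_lt x :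
  odd_root x -> first_label x < last_label (prv x).
Proof.
move=> root_x; have lt_x : (key x < key (prv x))%O.
  rewrite key_ltE key_leE len_prv leqnn (level_odd_root root_x).
  by rewrite level_prv_odd_root.
have := block_last_le_offset sz key_inj lt_x; have := sz_prv_odd_root root_x.
by rewrite /block_first /block_last (sz_odd_root root_x); lia.
Qed.

Definition endpoint_sum v : int :=
  (block_start key sz (odd \o pos) v + block_end key sz (odd \o pos) (prv v))%R.

Variant endpoint_sum_spec v : int -> Prop :=
| SinkSum of odd (pos v) & ~~ odd_root v :
    endpoint_sum_spec v (last_label (prv v) + last_label v)%:Z
| SourceSum of ~~ odd (pos v) & ~~ odd_root v :
    endpoint_sum_spec v (- (first_label (prv v) + first_label v)%:Z)%R
| RootSum of odd_root v :
    endpoint_sum_spec v ((last_label (prv v))%:Z - (first_label v)%:Z)%R.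

Lemma endpoint_sumP v : endpoint_sum_spec v (endpoint_sum v).
Proof.
rewrite /endpoint_sum /block_start /block_end /=.
case: (boolP (odd_root v)) => [root_v|turn_v].
  have [odd_v /eqP pos0] := andP root_v.
  have even_pred : odd (len v).-1 = false by have := len_gt1 v; lia.
  by rewrite pos_prv pos0 /cyc_pred /= even_pred addrC; exact: RootSum.
rewrite odd_pos_prv //; case: (boolP (odd (pos v))) => odd_v /=.
  by rewrite addrC -PoszD; exact: SinkSum.
by rewrite -opprD addrC -PoszD; exact: SourceSum.
Qed.

Lemma endpoint_sum_inj : injective endpoint_sum.
Proof.
move=> u v; case: endpoint_sumP => [odd_u turn_u|even_u turn_u|root_u];
  case: endpoint_sumP => [odd_v turn_v|even_v turn_v|root_v].
- have inj := junction_sum_inj (block_last_mono key_inj sz_gt0) turn_u turn_v.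
  by rewrite odd_u odd_v in inj => sumE; apply: inj; lia.
- by rewrite /block_first; lia.
- by have := last_prv_odd_root_lt_sink root_v odd_u; lia.
- by rewrite /block_first; lia.
- have inj := junction_sum_inj (block_first_mono key_inj sz_gt0) turn_u turn_v.
  by rewrite (negPf even_u) (negPf even_v) in inj => sumE; apply: inj; lia.
- by have := first_label_odd_root_lt root_v; lia.
- by have := last_prv_odd_root_lt_sink root_u odd_v; lia.
- by have := first_label_odd_root_lt root_u; lia.
case: (ltgtP (key u) (key v)) => [lt_uv|lt_vu|/key_inj //].
  by have := odd_root_sum_mono root_u root_v lt_uv; lia.
by have := odd_root_sum_mono root_v root_u lt_vu; lia.
Qed.

End ChunkOrder.

(** * Regular graphs *)

Lemma cyc_predK n i : i < n -> cyc_pred n (i.+1 %% n) = i.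
Proof.
rewrite leq_eqVlt => /orP[/eqP <-|lt_Sin]; first by rewrite modnn.
by rewrite modn_small.
Qed.

Lemma regular_degree (V : finType) (e : rel V) r v :
  regular e r -> \sum_w e v w = r.
Proof.
move=> reg; rewrite -(reg v) -sum1_card [RHS]big_mkcond.
by apply: eq_bigr => w _; rewrite inE; case: (e v w).
Qed.

Section RegularChunking.
Variables (V : finType) (e : rel V) (d : nat).
Variables (chunk : V -> seq V) (pos : V -> nat).
Hypotheses (e_sym : symmetric e) (e_irr : irreflexive e) (d_gt1 : 1 < d).
Hypothesis reg : regular e (2 * d).
Hypothesis ck : chunking e chunk pos.
Implicit Types u v w : V.

Let csym : connect_sym e := sym_connect_sym e_sym.

Definition comp_size v := #|component e v|.
Definition comp_rank v : nat := enum_rank (fingraph.root e v).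

Lemma comp_rank_connect u v : connect e u v <-> comp_rank u = comp_rank v.
Proof.
split=> [/(fingraph.rootP csym) uv|/val_inj/enum_rank_inj uv].
  by rewrite /comp_rank uv.
exact/(fingraph.rootP csym).
Qed.

Lemma comp_rank_size u v :
  comp_rank u = comp_rank v -> comp_size u = comp_size v.
Proof.
move=> /comp_rank_connect uv; apply: eq_card => w.
by rewrite !inE (same_connect csym uv).
Qed.

Lemma comp_rank_pos_inj u v :
  comp_rank u = comp_rank v -> pos u = pos v -> u = v.
Proof. by move=> /comp_rank_connect; exact: (pos_inj ck). Qed.

Lemma comp_rank_chunk_end v : comp_rank (last v (chunk v)) = comp_rank v.
Proof. by apply/esym/comp_rank_connect; exact: (connect_chunk_end ck). Qed.

Lemma comp_size_gt1 v : 1 < comp_size v.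
Proof.
have /card_gt0P[w] : 0 < #|[set w | e v w]| by rewrite reg; lia.
rewrite inE => vw; have v_neq_w : v != w.
  by apply: contraTneq vw => <-; rewrite e_irr.
suff : #|[set v; w]| <= comp_size v by rewrite cards2 v_neq_w.
apply: subset_leq_card; apply/subsetP=> z; rewrite !inE.
by case/orP=> /eqP->; rewrite ?connect0 ?connect1.
Qed.

Lemma pos_pred_chunk_end v :
  pos v = cyc_pred (comp_size v) (pos (last v (chunk v))).
Proof. by rewrite (pos_chunk_end ck) cyc_predK // (pos_lt_card ck). Qed.

Lemma chunk_end_inj : injective (fun v => last v (chunk v)).
Proof.
move=> u v same_end; have comp_rank_uv : comp_rank u = comp_rank v.
  by rewrite -comp_rank_chunk_end [last u _]same_end comp_rank_chunk_end.
apply: comp_rank_pos_inj => //; rewrite pos_pred_chunk_end [last u _]same_end.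
by rewrite (comp_rank_size comp_rank_uv) -pos_pred_chunk_end.
Qed.

Definition prv := invF chunk_end_inj.

Lemma chunk_end_prv v : last (prv v) (chunk (prv v)) = v.
Proof. exact: (f_invF chunk_end_inj). Qed.

Lemma chunk_end_eq u v : (last u (chunk u) == v) = (u == prv v).
Proof. by rewrite -{1}(chunk_end_prv v) (inj_eq chunk_end_inj). Qed.

Lemma comp_rank_prv v : comp_rank (prv v) = comp_rank v.
Proof. by rewrite -{2}(chunk_end_prv v) comp_rank_chunk_end. Qed.

Lemma pos_prv v : pos (prv v) = cyc_pred (comp_size v) (pos v).
Proof.
rewrite pos_pred_chunk_end chunk_end_prv.
by rewrite (comp_rank_size (comp_rank_prv v)).
Qed.

Lemma chunk_gt0 v : 0 < size (chunk v).
Proof.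
rewrite lt0n size_eq0; apply/eqP=> chunk0; have := pos_pred_chunk_end v.
by rewrite chunk0 /= /cyc_pred; have := comp_size_gt1 v; case: eqP; lia.
Qed.

Lemma sum_count_interior v : \sum_u count_mem v (interior u (chunk u)) = d.-1.
Proof.
have := regular_degree v reg.
under eq_bigr do rewrite -(sum_edge_count_chunk ck).
rewrite exchange_big /=.
have visits u : \sum_w edge_count v w (arcs u (chunk u)) =
    (u == v) + (u == prv v) + (count_mem v (interior u (chunk u))).*2.
  rewrite sum_edge_count_arcs -{2}(interior_last u (chunk_gt0 u)).
  rewrite -cats1 count_cat belast_interior ?chunk_gt0 //= chunk_end_eq.
  by lia.
under eq_bigr do rewrite visits.
rewrite !big_split /= -!big_mkcond /= !big_pred1_eq.
rewrite -(big_morph double doubleD double0); lia.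
Qed.

Lemma size_chunk_start v : pos v = 0 -> size (chunk v) = 1.
Proof.
move=> pos0; have := chunk_gt0 v; case chunkE: (chunk v) => [|y [|z p]] // _.
have [vy] : connect e v y /\ pos y <= pos v.
  by apply: (chunk_visits ck); rewrite chunkE !inE eqxx orbT.
rewrite pos0 leqn0 => /eqP pos_y; have yv : v = y.
  by apply: (pos_inj ck vy); rewrite pos0.
have : 0 < \sum_u edge_count v y (arcs u (chunk u)).
  by rewrite (bigD1 v) //= ltn_addr // edge_count_gt0 chunkE mem_head.
by rewrite (sum_edge_count_chunk ck) -yv e_irr.
Qed.

Lemma size_chunk_last v : (pos v).+1 = comp_size v -> 1 < size (chunk v).
Proof.
move=> pos_v; have : 0 < \sum_u count_mem v (interior u (chunk u)).
  by rewrite sum_count_interior; lia.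
rewrite lt0n sum_nat_eq0 negb_forall => /existsP[u].
rewrite -lt0n -has_count has_pred1 => v_in_u.
have [uv le_vu] := chunk_visits ck (mem_behead v_in_u).
have uv_eq : u = v.
  apply: (pos_inj ck uv); apply/eqP; rewrite eqn_leq le_vu andbT.
  have size_uv := comp_rank_size ((comp_rank_connect u v).1 uv).
  by rewrite -ltnS pos_v -size_uv (pos_lt_card ck).
by rewrite -uv_eq; case: (chunk u) v_in_u => [|x []].
Qed.

Local Notation ordering_key := (key pos comp_size comp_rank).
Local Notation chunk_size := (fun v => size (chunk v)).

Lemma ordering_key_inj : injective ordering_key.
Proof. exact: key_inj (pos_lt_card ck) comp_rank_pos_inj. Qed.

Lemma chunk_endpoint_sum_inj :
  injective (endpoint_sum prv pos comp_size comp_rank chunk_size).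
Proof.
have start_size v : odd_root pos comp_size v -> chunk_size v = 1.
  by case/andP=> _ /eqP; exact: size_chunk_start.
have last_size v : odd_root pos comp_size v -> 1 < chunk_size (prv v).
  case/andP=> _ /eqP pos0; apply: size_chunk_last.
  rewrite pos_prv pos0 /cyc_pred /=.
  by rewrite (comp_rank_size (comp_rank_prv v)) prednK // ltnW // comp_size_gt1.
exact (endpoint_sum_inj comp_size_gt1 (pos_lt_card ck) comp_rank_pos_inj
  comp_rank_size comp_rank_prv pos_prv chunk_gt0 start_size last_size).
Qed.

Lemma chunking_antimagic_orientation : has_antimagic_orientation e.
Proof.
have [o [f [orient label sumE]]] := chunk_labeling (odd \o pos)
  (sum_edge_count_chunk ck) chunk_gt0 chunk_end_eq ordering_key_inj.
exists o, f; split=> // u v; rewrite !sumE !sum_count_interior => /addIr.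
exact: chunk_endpoint_sum_inj.
Qed.

End RegularChunking.

Theorem even_regular_antimagic_orientation (d : nat) (V : finType) (e : rel V) :
  1 < d -> simple_graph e -> regular e (2 * d) -> has_antimagic_orientation e.
Proof.
move=> d_gt1 [e_sym e_irr] reg.
have even v : ~~ odd (\sum_w e v w) by rewrite (regular_degree v reg) oddM.
have [chunk [pos ck]] := chunking_exists e_sym e_irr even.
exact: chunking_antimagic_orientation e_sym e_irr d_gt1 reg ck.
Qed.

Theorem theorem1 (d : nat) (V : finType) (e : rel V) :
  2 <= d ->
  simple_graph e ->
  regular e (2 * d) ->
  let k := #|odd_components e| in
  (k <= 5 * d + 4 -> has_antimagic_orientation e) /\
  (5 * d + 5 <= k ->
   forall x0 : nat, 0 < x0 ->
   ((exists2 r, r <= d + 8 & k = (2 * d - 2) * (x0 + 2) + r) \/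
    (exists2 r, d + 9 <= r <= 2 * d - 3 & k = (2 * d - 2) * (x0 + 1) + r)) ->
   (forall C, C \in odd_components e -> 2 * x0 + 5 <= #|C|) ->
   has_antimagic_orientation e).
Proof.
move=> d_gt1 simple_e reg_e k.
have antimagic := even_regular_antimagic_orientation d_gt1 simple_e reg_e.
by split=> [_|_ x0 _ _ _].
Qed.
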